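(* Let $n,m\ge1$ be integers, $p\in(0,1)$, $q=1-p$, and let $\pi\sim\nu^{(p)}_{n,m}$. Then $$\mathbb{E}\left[t^{\operatorname{inv}(\pi)}\right]=\sum_{(\mathbf{a},\mathbf{b})\in\mathcal{AB}(m,n)}\left[\begin{matrix}n\\ (\mathbf{a},\mathbf{b})\end{matrix}\right]_t\cdot\prod_{j=1}^m t^{\binom{b_j}{2}}\cdot\left(\frac pm\right)^{|\mathbf{a}|}\left(\frac qm\right)^{|\mathbf{b}|}=\frac{(t;t)_n}{m^n}[z^n]\left(\frac{(-qz;t)_\infty}{(pz;t)_\infty}\right)^m$$ as formal power series in $t$.
   Context: Asymmetric shelf shuffle: let $m\ge 1$ be an integer, $p\in(0,1)$, $q=1-p$. A deck of $n$ cards labelled $1,\ldots,n$ from top to bottom is dealt sequentially from the bottom (card $n$ first, card $1$ last). Each card is assigned to one of $m$ labelled shelves independently and uniformly at random, and is placed at the top of the existing pile on that shelf with probability $p$ and at the bottom with probability $q$, independently of everything else. The shuffled deck is formed by joining the piles in shelf order (shelf $1$ on top, then shelf $2$, and so on). The resulting random permutation is $\pi=(\pi_1,\ldots,\pi_n)\in S_n$, where $\pi_i$ is the label of the card in position $i$ from the top, and $\nu^{(p)}_{n,m}$ denotes its law on $S_n$. $\operatorname{inv}(\pi)=|\{(i,j):1\le i<j\le n,\ \pi_i>\pi_j\}|$ is the number of inversions. For $r\ge0$, $(a;t)_r:=\prod_{j=0}^{r-1}(1-at^j)$ and $(a;t)_\infty:=\prod_{j\ge0}(1-at^j)$, as formal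 power series. $$\mathcal{AB}(m,n):=\Bigl\{(a_1,b_1,\ldots,a_m,b_m)\in\mathbb{Z}_{\ge0}^{2m}:\ \sum_{i=1}^m(a_i+b_i)=n\Bigr\};$$ its elements are written $(\mathbf{a},\mathbf{b})$, with $|\mathbf{a}|=\sum_i a_i$, $|\mathbf{b}|=\sum_i b_i$. The $t$-multinomial coefficient is $$\left[\begin{matrix}n\\ (\mathbf{a},\mathbf{b})\end{matrix}\right]_t:=\frac{(t;t)_n}{\prod_{j=1}^m(t;t)_{a_j}(t;t)_{b_j}}.$$ $[z^n]$ denotes the coefficient of $z^n$. *)

(* Defs.v *)
From HB Require Import structures.
From mathcomp Require Import all_boot all_order all_algebra fingroup perm.
From mathcomp Require Import boolp classical_sets reals.

Set Implicit Arguments.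
Unset Strict Implicit.
Unset Printing Implicit Defensive.

Import Order.TTheory GRing.Theory Num.Theory.
Local Open Scope ring_scope.

Record fps (R : Type) := FPS { fcoef : nat -> R }.

Notation "{ 'fps' R }" := (fps R) (format "{ 'fps'  R }") : type_scope.
Lemma fpsP (R : Type) (f g : {fps R}) :
  (forall n, fcoef f n = fcoef g n) -> f = g.
Proof. by case: f g => [f] [g] /= fg; congr FPS; apply: funext. Qed.

HB.instance Definition _ (R : Type) := gen_eqMixin {fps R}.
HB.instance Definition _ (R : Type) := gen_choiceMixin {fps R}.

Definition fps_zero (R : zmodType) : {fps R} := FPS (fun=> 0).
Definition fps_opp (R : zmodType) (f : {fps R}) : {fps R} :=
  FPS (fun n => - fcoef f n).
Definition fps_add (R : zmodType) (f g : {fps R}) : {fps R} :=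
  FPS (fun n => fcoef f n + fcoef g n).

Lemma fps_addA (R : zmodType) : associative (@fps_add R).
Proof. by move=> f g h; apply: fpsP => n /=; rewrite addrA. Qed.
Lemma fps_addC (R : zmodType) : commutative (@fps_add R).
Proof. by move=> f g; apply: fpsP => n /=; rewrite addrC. Qed.
Lemma fps_add0 (R : zmodType) : left_id (fps_zero R) (@fps_add R).
Proof. by move=> f; apply: fpsP => n /=; rewrite add0r. Qed.
Lemma fps_addN (R : zmodType) :
  left_inverse (fps_zero R) (@fps_opp R) (@fps_add R).
Proof. by move=> f; apply: fpsP => n /=; rewrite addNr. Qed.

HB.instance Definition _ (R : zmodType) :=
  GRing.isZmodule.Build {fps R}
    (@fps_addA R) (@fps_addC R) (@fps_add0 R) (@fps_addN R).

Definition fps_one (R : comNzRingType) : {fps R} := FPS (fun n => (n == 0)%:R).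
Definition fps_mul (R : comNzRingType) (f g : {fps R}) : {fps R} :=
  FPS (fun n => \sum_(i < n.+1) fcoef f i * fcoef g (n - i)).

Lemma fps_mul_trunc (R : comNzRingType) (f g : {fps R}) (N n : nat) :
  (n <= N)%N ->
  fcoef (fps_mul f g) n =
    ((\poly_(i < N.+1) fcoef f i) * (\poly_(i < N.+1) fcoef g i))`_n.
Proof.
move=> nN; rewrite coefM /=; apply: eq_bigr => i _; rewrite !coef_poly.
have iN : (i < N.+1)%N by rewrite (leq_trans (ltn_ord i)).
by rewrite iN ltnS (leq_trans (leq_subr _ _) nN).
Qed.

Lemma fps_mulC (R : comNzRingType) : commutative (@fps_mul R).
Proof.
by move=> f g; apply: fpsP => n; rewrite !(@fps_mul_trunc _ _ _ n) // mulrC.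
Qed.

Lemma fps_mulA (R : comNzRingType) : associative (@fps_mul R).
Proof.
move=> f g h; apply: fpsP => n.
pose P (u : {fps R}) := \poly_(i < n.+1) fcoef u i.
transitivity ((P f * (P g * P h))`_n).
  rewrite coefM /=; apply: eq_bigr => i _.
  rewrite /P coef_poly ltn_ord; congr (_ * _).
  by rewrite -fps_mul_trunc // leq_subr.
rewrite mulrA coefM /=; apply: eq_bigr => i _.
rewrite [X in _ * X = _]coef_poly ltnS leq_subr; congr (_ * _).
by rewrite -fps_mul_trunc // -ltnS.
Qed.

Lemma fps_mul1 (R : comNzRingType) : left_id (fps_one R) (@fps_mul R).
Proof.
move=> f; apply: fpsP => n /=.
rewrite big_ord_recl /= mul1r subn0 big1 ?addr0 // => i _.
by rewrite mul0r.
Qed.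

Lemma fps_mulDl (R : comNzRingType) :
  left_distributive (@fps_mul R) (@fps_add R).
Proof.
move=> f g h; apply: fpsP => n /=; rewrite -big_split /=.
by apply: eq_bigr => i _; rewrite mulrDl.
Qed.

Lemma fps_one_neq0 (R : comNzRingType) : fps_one R != 0.
Proof.
apply/eqP => /(congr1 (fun f : {fps R} => fcoef f 0)) /= /eqP.
by rewrite oner_eq0.
Qed.

HB.instance Definition _ (R : comNzRingType) :=
  GRing.Zmodule_isComNzRing.Build {fps R}
    (@fps_mulA R) (@fps_mulC R) (@fps_mul1 R) (@fps_mulDl R) (@fps_one_neq0 R).

Lemma fcoefD (R : zmodType) (f g : {fps R}) n :
  fcoef (f + g) n = fcoef f n + fcoef g n.
Proof. by []. Qed.

Lemma fcoefN (R : zmodType) (f : {fps R}) n : fcoef (- f) n = - fcoef f n.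
Proof. by []. Qed.

Lemma fcoef0 (R : zmodType) n : fcoef (0 : {fps R}) n = 0.
Proof. by []. Qed.

Lemma fcoef1 (R : comNzRingType) n : fcoef (1 : {fps R}) n = (n == 0)%:R.
Proof. by []. Qed.

Lemma fcoefM (R : comNzRingType) (f g : {fps R}) n :
  fcoef (f * g) n = \sum_(i < n.+1) fcoef f i * fcoef g (n - i).
Proof. by []. Qed.

Lemma fcoef_sum (R : zmodType) (I : Type) (r : seq I) (P : pred I)
    (F : I -> {fps R}) n :
  fcoef (\sum_(i <- r | P i) F i) n = \sum_(i <- r | P i) fcoef (F i) n.
Proof. by apply: (big_morph (fun f : {fps R} => fcoef f n)). Qed.

Definition fpsC (R : zmodType) (c : R) : {fps R} :=
  FPS (fun n => if n == 0 then c else 0).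
Definition fpsX (R : comNzRingType) : {fps R} := FPS (fun n => (n == 1)%:R).

Lemma fcoefCM (R : comNzRingType) (c : R) (f : {fps R}) n :
  fcoef (fpsC c * f) n = c * fcoef f n.
Proof.
rewrite fcoefM big_ord_recl /= subn0 big1 ?addr0 // => i _.
by rewrite mul0r.
Qed.

Lemma fcoef_exp_lt (R : comNzRingType) (f : {fps R}) k n :
  fcoef f 0 = 0 -> (n < k)%N -> fcoef (f ^+ k) n = 0.
Proof.
move=> f0; elim: k n => // k IH n nk; rewrite exprS fcoefM.
rewrite big_ord_recl f0 mul0r add0r big1 // => i _.
rewrite [X in _ * X]IH ?mulr0 //= /bump /=; case: n nk i => [|n] nk i.
  by case: i.
by rewrite add1n subSS (leq_ltn_trans (leq_subr _ _)).
Qed.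

(* With c the inverse of the constant term of f, c f = 1 - u where u has zero
   constant term, so f^-1 = c * sum_k u^k; only the terms k <= n contribute to
   the n-th coefficient. *)
Definition fps_unit (R : comUnitRingType) : {pred {fps R}} :=
  [pred f : {fps R} | fcoef f 0 \is a GRing.unit].
Definition fps_inv (R : comUnitRingType) (f : {fps R}) : {fps R} :=
  if f \in @fps_unit R then
    let c := (fcoef f 0)^-1 in
    let u := 1 - fpsC c * f in
    FPS (fun n => c * fcoef (\sum_(k < n.+1) u ^+ k) n)
  else f.

Lemma fps_mulVx (R : comUnitRingType) :
  {in @fps_unit R, left_inverse 1 (@fps_inv R) *%R}.
Proof.
move=> f uf; rewrite /fps_inv uf; move: uf; rewrite inE => uf.
set c := (_)^-1; set u := 1 - _.
have u0 : fcoef u 0 = 0 by rewrite fcoefD fcoefN fcoefCM mulVr // subrr.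
have cf : fpsC c * f = 1 - u by rewrite /u opprB addrCA subrr addr0.
move: u0 cf; clearbody u => u0 cf.
apply: fpsP => n; pose S N := \sum_(k < N.+1) u ^+ k.
have stab N i : (i <= N)%N -> fcoef (S i) i = fcoef (S N) i.
  elim: N => [|N IH]; first by rewrite leqn0 => /eqP->.
  rewrite leq_eqVlt => /orP[/eqP->//|iN].
  by rewrite [in RHS]/S big_ord_recr fcoefD /= fcoef_exp_lt // addr0 IH.
transitivity (fcoef (fpsC c * S n * f) n).
  rewrite !fcoefM; apply: eq_bigr => i _; congr (_ * _); rewrite fcoefCM.
  by apply: (congr1 ( *%R c)); apply: stab; rewrite -ltnS.
have -> : fpsC c * S n * f = 1 - u ^+ n.+1.
  by rewrite mulrAC cf -[RHS]opprB subrX1 -mulNr opprB.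
by rewrite fcoefD fcoefN fcoef_exp_lt // oppr0 addr0.
Qed.

Lemma fps_unitPl (R : comUnitRingType) (f g : {fps R}) :
  g * f = 1 -> @fps_unit R f.
Proof.
move/(congr1 (fun h : {fps R} => fcoef h 0)).
rewrite fcoefM big_ord1 fcoef1 /= => gf.
by apply/unitrPr; exists (fcoef g 0); rewrite mulrC.
Qed.

Lemma fps_invr_out (R : comUnitRingType) :
  {in [predC @fps_unit R], @fps_inv R =1 id}.
Proof. by move=> f; rewrite inE /fps_inv => /negbTE ->. Qed.

HB.instance Definition _ (R : comUnitRingType) :=
  GRing.ComNzRing_hasMulInverse.Build {fps R}
    (@fps_mulVx R) (@fps_unitPl R) (@fps_invr_out R).

Lemma fps_unitE (R : comUnitRingType) (f : {fps R}) :
  (f \is a GRing.unit) = (fcoef f 0 \is a GRing.unit).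
Proof. by []. Qed.

Definition qpoch (A : comNzRingType) (a t : A) (r : nat) : A :=
  \prod_(j < r) (1 - a * t ^+ j).

Lemma qpochS (A : comNzRingType) (a t : A) (r : nat) :
  qpoch a t r.+1 = qpoch a t r * (1 - a * t ^+ r).
Proof. by rewrite /qpoch big_ord_recr. Qed.

(* The limit of an eventually constant sequence (0 for other sequences). *)
Definition evlim (R : zmodType) (u : nat -> R) : R :=
  xget 0 [set l | exists N, forall r, (N <= r)%N -> u r = l]%classic.

(* R[[t]][[z]] is encoded as {fps {fps R}}: the outer variable is z, the inner
   one is t.  Limits are taken coefficientwise. *)
Definition fps2_lim (R : zmodType) (u : nat -> {fps {fps R}}) :
    {fps {fps R}} :=
  FPS (fun i => FPS (fun k => evlim (fun r => fcoef (fcoef (u r) i) k))).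

Definition qpoch_inf (R : comNzRingType) (a t : {fps {fps R}}) :
    {fps {fps R}} :=
  fps2_lim (qpoch a t).

(* (c z; t)_oo *)
Definition qpoch_infz (R : comNzRingType) (c : R) : {fps {fps R}} :=
  qpoch_inf (fpsC (fpsC c) * fpsX {fps R}) (fpsC (fpsX R)).

Lemma evlim_eq (R : zmodType) (u : nat -> R) (N : nat) (l : R) :
  (forall r, (N <= r)%N -> u r = l) -> evlim u = l.
Proof.
move=> ul; apply: xget_unique; first by exists N.
move=> y [N' uy]; rewrite -(ul (maxn N N')) ?leq_maxl //.
by rewrite uy // leq_maxr.
Qed.

Lemma fpsC_exp (R : comNzRingType) (c : R) r : fpsC c ^+ r = fpsC (c ^+ r).
Proof.
elim: r => [|r IH]; first by apply: fpsP => -[].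
rewrite !exprS IH; apply: fpsP => n; rewrite fcoefCM /=.
by case: eqP => // _; rewrite mulr0.
Qed.

(* Hence the limit defining (a; t)_oo always exists. *)
Lemma qpoch_inf_coef (R : comNzRingType) (a : {fps {fps R}}) (i k r : nat) :
  (k < r)%N ->
  fcoef (fcoef (qpoch_inf a (fpsC (fpsX R))) i) k
  = fcoef (fcoef (qpoch a (fpsC (fpsX R)) r) i) k.
Proof.
move=> kr; apply: (@evlim_eq _ _ r) => s; elim: s => [|s IH].
  by rewrite leqn0 => /eqP ->.
rewrite leq_eqVlt => /orP[/eqP-> //|rs]; rewrite -(IH rs) {IH}.
rewrite qpochS mulrBr mulr1.
have coefB (f g : {fps {fps R}}) :
  fcoef (fcoef (f - g) i) k = fcoef (fcoef f i) k - fcoef (fcoef g i) k by [].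
rewrite coefB fpsC_exp mulrA [X in _ - fcoef (fcoef X _) _]mulrC fcoefCM.
rewrite [X in _ - X](_ : _ = 0) ?subr0 // fcoefM big1 // => j _.
rewrite fcoef_exp_lt ?mul0r //.
exact: leq_trans (leq_trans (ltn_ord j) kr) rs.
Qed.

Lemma qpoch_infz_unit (R : comUnitRingType) (c : R) :
  qpoch_infz c \is a GRing.unit.
Proof.
rewrite !fps_unitE (@qpoch_inf_coef _ _ _ _ 1) // /qpoch big_ord1.
set a := fpsC _ * _; have a0 : fcoef a 0 = 0 by rewrite fcoefCM mulr0.
have -> : fcoef (1 - a * fpsC (fpsX R) ^+ 0) 0 = 1.
  by rewrite expr0 mulr1 fcoefD fcoefN a0 subr0.
exact: unitr1.
Qed.

(* Cards 1, ..., n and positions are encoded as 0, ..., n - 1; the head of a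
   sequence of cards is its top.  A choice function w tells for each card its
   shelf and whether it goes to the top of the pile. *)
Definition choices (n m : nat) := {ffun 'I_n -> 'I_m * bool}.

Definition place (n m : nat) (w : choices n m) (c : 'I_n)
    (piles : 'I_m -> seq 'I_n) : 'I_m -> seq 'I_n :=
  fun s =>
    if s == (w c).1 then
      if (w c).2 then c :: piles s else rcons (piles s) c
    else piles s.

(* enum 'I_n is increasing and foldr consumes it from the right, so the card
   with the largest label is dealt first. *)
Definition shelf_piles (n m : nat) (w : choices n m) : 'I_m -> seq 'I_n :=
  foldr (place w) (fun=> [::]) (enum 'I_n).

Definition deck (n m : nat) (w : choices n m) : seq 'I_n :=
  flatten [seq shelf_piles w s | s <- enum 'I_m].

Lemma deck_perm_eq (n m : nat) (w : choices n m) :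
  perm_eq (deck w) (enum 'I_n).
Proof.
rewrite /deck /shelf_piles; apply/seq.permP => a.
rewrite count_flatten -map_comp sumnE big_map big_enum /=.
elim: (enum 'I_n) => [|c s IH] /=; first by rewrite big1.
rewrite -{}IH (bigD1 (w c).1) //= [in RHS](bigD1 (w c).1) //= addnA; congr (_ + _)%N.
  rewrite /place eqxx; case: (w c).2 => //=.
  by rewrite -cats1 count_cat /= addn0 addnC.
by apply: eq_bigr => i /negbTE ic; rewrite /place ic.
Qed.

Lemma deck_size (n m : nat) (w : choices n m) : size (deck w) == n.
Proof. by rewrite (perm_size (deck_perm_eq w)) size_enum_ord. Qed.

Lemma deck_inj (n m : nat) (w : choices n m) :
  injective (tnth (Tuple (deck_size w))).
Proof.
by apply/tuple_uniqP; rewrite (perm_uniq (deck_perm_eq w)) enum_uniq.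
Qed.

Definition shelf_perm (n m : nat) (w : choices n m) : 'S_n :=
  perm (@deck_inj n m w).

Definition choices_prob (R : realType) (n m : nat) (p : R) (w : choices n m) :
    R :=
  \prod_(c < n) (m%:R^-1 * (if (w c).2 then p else 1 - p)).

Definition shelf_law (R : realType) (n m : nat) (p : R) (s : 'S_n) : R :=
  \sum_(w : choices n m | shelf_perm w == s) choices_prob p w.
Arguments shelf_law {R} n m p s.

Lemma shelf_law_ge0 (R : realType) (n m : nat) (p : R) (s : 'S_n) :
  0 < p < 1 -> 0 <= shelf_law n m p s.
Proof.
case/andP=> p0 p1; apply: sumr_ge0 => w _; apply: prodr_ge0 => c _.
by rewrite mulr_ge0 ?invr_ge0 //; case: ifP => _; rewrite ?subr_ge0 ltW.
Qed.

Lemma shelf_law_sum1 (R : realType) (n m : nat) (p : R) :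
  (0 < m)%N -> \sum_(s : 'S_n) shelf_law n m p s = 1.
Proof.
move=> m0; transitivity (\sum_(w : choices n m) choices_prob p w).
  by rewrite (partition_big (@shelf_perm n m) predT).
pose F (_ : 'I_n) (x : 'I_m * bool) : R :=
  m%:R^-1 * (if x.2 then p else 1 - p).
rewrite -(bigA_distr_bigA F) big1 // => c _.
rewrite -(pair_bigA _ (fun (i : 'I_m) (b : bool) => F c (i, b))) /=.
transitivity (\sum_(i < m) (m%:R^-1 : R)).
  by apply: eq_bigr => i _; rewrite big_bool /F /= -mulrDr addrC subrK mulr1.
by rewrite sumr_const card_ord -[LHS]mulr_natr mulVf // pnatr_eq0 -lt0n.
Qed.

Definition perm_ninv (n : nat) (s : 'S_n) : nat :=
  #|[set ij : 'I_n * 'I_n | (ij.1 < ij.2)%N && (s ij.2 < s ij.1)%N]|.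

(* mu is a law on S_n; since S_n is finite, the expectation of an R[[t]]-valued
   variable is a finite sum. *)
Definition fps_expect (R : realType) (n : nat) (mu : 'S_n -> R)
    (X : 'S_n -> {fps R}) : {fps R} :=
  \sum_(s : 'S_n) fpsC (mu s) * X s.

Definition wcomp (m n : nat) := {ffun 'I_m -> 'I_n.+1}.

Definition vsum (m n : nat) (a : wcomp m n) : nat := (\sum_(j < m) a j)%N.

(* Entries of a pair in AB(m, n) are at most n, hence the use of 'I_n.+1. *)
Definition AB (m n : nat) : {set wcomp m n * wcomp m n} :=
  [set ab : wcomp m n * wcomp m n |
    (\sum_(j < m) (ab.1 j + ab.2 j))%N == n].

Lemma AB_complete (m n : nat) (a b : 'I_m -> nat) :
  (\sum_(j < m) (a j + b j))%N = n ->
  exists2 ab, ab \in AB m n &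
    forall j, nat_of_ord (ab.1 j) = a j /\ nat_of_ord (ab.2 j) = b j.
Proof.
move=> abn.
have le j : (a j + b j <= n)%N by rewrite -abn (bigD1 j) //= leq_addr.
have ha j : (a j < n.+1)%N by rewrite ltnS (leq_trans _ (le j)) ?leq_addr.
have hb j : (b j < n.+1)%N by rewrite ltnS (leq_trans _ (le j)) ?leq_addl.
exists ([ffun j => Ordinal (ha j)], [ffun j => Ordinal (hb j)]).
  by rewrite inE -[X in _ == X]abn; apply/eqP/eq_bigr => j _; rewrite !ffunE.
by move=> j; rewrite !ffunE.
Qed.

Definition tmultinom (R : realType) (m n : nat) (ab : wcomp m n * wcomp m n) :
    {fps R} :=
  let t := fpsX R in
  qpoch t t n / \prod_(j < m) (qpoch t t (ab.1 j) * qpoch t t (ab.2 j)).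
Arguments tmultinom R {m n} ab.

(* Main.v *)
Require Import Defs.
From HB Require Import structures.
From mathcomp Require Import all_boot all_order all_algebra fingroup perm.
From mathcomp Require Import reals.
From mathcomp Require Import zify ring.

(** Why the theorem is true.

    Call a pair (shelf, top or bottom) a letter, so that a run of the shuffle
    is a word with one letter per card.  Card 1 is dealt last, and it is
    smaller than every other card: inserting it creates one inversion with each
    card lying above it.  If its letter is (s, top), these are the cards on the
    shelves before s; if it is (s, bottom), they are the cards on the shelves
    up to and including s.  In both cases they are the cards on the shelves
    k < cutoff (numbering from 0), with cutoff = s or s + 1 ([ninv_cons]).

    Give each letter l a weight x_l, and let W_n(x) be the sum over all words
    of the product of the weights times t^inv.  Splitting off card 1 gives the
    recursion [word_gfS]
      W_(n+1)(x) = sum_l x_l W_n(x twisted by l),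
    where the twist multiplies by t the weights of the shelves below the cutoff
    of l.

    The same recursion is solved by a product of Euler series.  Put
      e(z) = sum_a z^a / (t;t)_a,   E(z) = sum_b t^C(b,2) z^b / (t;t)_b,
      H(z) = prod_s e(x_(s,top) z) E(x_(s,bottom) z).
    The equations e(tz) = (1 - z) e(z) and E(z) = (1 + z) E(tz) express the
    effect of dilating one shelf factor; replacing z by tz in the factors of H
    one shelf after the other makes H(z) - H(tz) a telescoping sum, equal to z
    times the sum of x_l H(x twisted by l) ([shelves_gf_step]).  Comparing the
    coefficients of z^(n+1) yields W_n(x) = (t;t)_n [z^n] H
    ([word_gf_shelves]).

    With the weights p/m and q/m, W_n is the expectation; expanding the product
    H coefficientwise gives the sum over AB(m, n) ([fcoef_prod2]); and Euler's
    identities e(pz) = 1 / (pz;t)_oo ([qpoch_infz_qexp]) and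
    E(qz) = (-qz;t)_oo ([qpoch_infz_qExp]) give the infinite product form, the
    factor m^-n coming from the dilation z -> z/m. *)

Set Implicit Arguments.
Unset Strict Implicit.
Unset Printing Implicit Defensive.

Import Order.TTheory GRing.Theory Num.Theory.
Local Open Scope ring_scope.

(** * Constants, dilations and powers of the variable *)

Lemma fpsC_is_zmod_morphism (K : comNzRingType) : zmod_morphism (@fpsC K).
Proof. by move=> a b; apply: fpsP => -[|k] //=; rewrite oppr0 addr0. Qed.

Lemma fpsC_is_monoid_morphism (K : comNzRingType) : monoid_morphism (@fpsC K).
Proof.
split; first by apply: fpsP => -[].
by move=> a b; apply: fpsP => -[|k]; rewrite fcoefCM //= mulr0.
Qed.

HB.instance Definition _ (K : comNzRingType) :=
  GRing.isZmodMorphism.Build K {fps K} (@fpsC K) (@fpsC_is_zmod_morphism K).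
HB.instance Definition _ (K : comNzRingType) :=
  GRing.isMonoidMorphism.Build K {fps K} (@fpsC K)
    (@fpsC_is_monoid_morphism K).

(** The substitution z -> u z. *)
Definition dilate (K : comNzRingType) (u : K) (f : {fps K}) : {fps K} :=
  FPS (fun n => u ^+ n * fcoef f n).

Lemma fcoef_dilate (K : comNzRingType) (u : K) (f : {fps K}) n :
  fcoef (dilate u f) n = u ^+ n * fcoef f n.
Proof. by []. Qed.

Lemma dilate_is_zmod_morphism (K : comNzRingType) (u : K) :
  zmod_morphism (dilate u).
Proof. by move=> f g; apply: fpsP => n /=; rewrite -mulrN -mulrDr. Qed.

Lemma dilate_is_monoid_morphism (K : comNzRingType) (u : K) :
  monoid_morphism (dilate u).
Proof.
split; first by apply: fpsP => -[|n] /=; rewrite ?mulr1 ?mulr0.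
move=> f g; apply: fpsP => n; rewrite fcoefM /= mulr_sumr.
apply: eq_bigr => i _; rewrite mulrACA -exprD subnKC //.
by rewrite -ltnS.
Qed.

HB.instance Definition _ (K : comNzRingType) (u : K) :=
  GRing.isZmodMorphism.Build {fps K} {fps K} (dilate u)
    (@dilate_is_zmod_morphism K u).
HB.instance Definition _ (K : comNzRingType) (u : K) :=
  GRing.isMonoidMorphism.Build {fps K} {fps K} (dilate u)
    (@dilate_is_monoid_morphism K u).

Lemma dilate_comp (K : comNzRingType) (u v : K) (f : {fps K}) :
  dilate u (dilate v f) = dilate (u * v) f.
Proof. by apply: fpsP => n /=; rewrite exprMn mulrA. Qed.

Lemma dilateX (K : comNzRingType) (u : K) :
  dilate u (fpsX K) = fpsC u * fpsX K.
Proof.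
by apply: fpsP => -[|[|n]]; rewrite fcoefCM //= ?mulr0 ?mulr1 ?expr1.
Qed.

Lemma dilateC (K : comNzRingType) (u c : K) : dilate u (fpsC c) = fpsC c.
Proof. by apply: fpsP => -[|n] /=; rewrite ?mul1r ?mulr0. Qed.

Lemma fcoefXM0 (K : comNzRingType) (f : {fps K}) : fcoef (fpsX K * f) 0 = 0.
Proof. by rewrite fcoefM big_ord1 mul0r. Qed.

Lemma fcoefXMS (K : comNzRingType) (f : {fps K}) n :
  fcoef (fpsX K * f) n.+1 = fcoef f n.
Proof.
rewrite fcoefM big_ord_recl mul0r add0r big_ord_recl /= mul1r subn1 /=.
by rewrite big1 ?addr0 // => i _; rewrite mul0r.
Qed.

Lemma fcoefXnM (K : comNzRingType) (f : {fps K}) r n :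
  fcoef (fpsX K ^+ r * f) n = if (r <= n)%N then fcoef f (n - r) else 0.
Proof.
elim: r n => [|r IH] n; first by rewrite expr0 mul1r leq0n subn0.
rewrite exprS -mulrA; case: n => [|n]; first by rewrite fcoefXM0.
by rewrite fcoefXMS IH subSS.
Qed.

(** * Euler's two series

    Their functional equations only require every 1 - t^k, k > 0, to be
    invertible, as is the case in R[[t]]. *)

(** The series called e(z) in the introduction. *)
Definition qexp (K : comUnitRingType) (t : K) : {fps K} :=
  FPS (fun n => (qpoch t t n)^-1).
(** The series called E(z) in the introduction. *)
Definition qExp (K : comUnitRingType) (t : K) : {fps K} :=
  FPS (fun n => t ^+ 'C(n, 2) / qpoch t t n).

Lemma qpoch_unit (K : comUnitRingType) (t : K) :
  (forall n, 1 - t ^+ n.+1 \is a GRing.unit) ->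
  forall n, qpoch t t n \is a GRing.unit.
Proof.
move=> ut; elim=> [|n IH]; first by rewrite /qpoch big_ord0 unitr1.
by rewrite qpochS unitrM IH -exprS ut.
Qed.

Lemma qpoch_invS (K : comUnitRingType) (t : K) :
  (forall n, 1 - t ^+ n.+1 \is a GRing.unit) ->
  forall n, (1 - t ^+ n.+1) / qpoch t t n.+1 = (qpoch t t n)^-1.
Proof.
move=> ut n; rewrite qpochS -exprS invrM ?qpoch_unit ?ut //.
by rewrite mulrA divrr ?ut // mul1r.
Qed.

Lemma dilate_qexp (K : comUnitRingType) (t : K) :
  (forall n, 1 - t ^+ n.+1 \is a GRing.unit) ->
  dilate t (qexp t) = (1 - fpsX K) * qexp t.
Proof.
move=> ut; apply: fpsP => n.
rewrite mulrBl mul1r fcoefD fcoefN.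
case: n => [|n]; first by rewrite fcoefXM0 /= mul1r subr0.
by rewrite fcoefXMS /= -(qpoch_invS ut n) mulrBl mul1r subKr.
Qed.

Lemma qExp_dilate (K : comUnitRingType) (t : K) :
  (forall n, 1 - t ^+ n.+1 \is a GRing.unit) ->
  qExp t = (1 + fpsX K) * dilate t (qExp t).
Proof.
move=> ut; apply: fpsP => n.
rewrite mulrDl mul1r fcoefD.
case: n => [|n]; first by rewrite fcoefXM0 addr0 /= expr0 mul1r.
rewrite fcoefXMS /= binS bin1 exprD -(qpoch_invS ut n); ring.
Qed.

(** How a q-difference equation determines a series: f and g satisfy inverse
    equations, so f g is invariant under z -> t z, which kills every
    coefficient but the constant one because 1 - t^n is invertible. *)
Lemma fps_dilate_inv (K : comUnitRingType) (t : K) (u f g : {fps K}) :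
  (forall n, 1 - t ^+ n.+1 \is a GRing.unit) ->
  fcoef f 0 = 1 -> fcoef g 0 = 1 ->
  f = u * dilate t f -> dilate t g = u * g -> f * g = 1.
Proof.
move=> ut f0 g0 fu gu.
have inv : f * g = dilate t (f * g) by rewrite rmorphM /= gu {1}fu; ring.
apply: fpsP => -[|n]; first by rewrite fcoefM big_ord1 f0 g0 mulr1.
have /eqP : (1 - t ^+ n.+1) * fcoef (f * g) n.+1 = 0.
  by rewrite mulrBl mul1r {1}inv subrr.
move=> /eqP /(congr1 ( *%R (1 - t ^+ n.+1)^-1)).
by rewrite mulKr ?ut // mulr0.
Qed.

Lemma fpsX_pow_unit (R : comUnitRingType) n :
  1 - fpsX R ^+ n.+1 \is a GRing.unit.
Proof.
by rewrite fps_unitE fcoefD fcoefN -[_ ^+ _]mulr1 fcoefXnM /= subr0 unitr1.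
Qed.

(** Dilating by t shifts all factors of (cz; t)_r by one; only the first factor
    of (cz; t)_(r+1) is missing. *)
Lemma dilate_qpoch (R : comNzRingType) (c : R) r :
  dilate (fpsX R) (qpoch (fpsC (fpsC c) * fpsX {fps R}) (fpsC (fpsX R)) r) *
     (1 - fpsC (fpsC c) * fpsX {fps R}) =
  qpoch (fpsC (fpsC c) * fpsX {fps R}) (fpsC (fpsX R)) r.+1.
Proof.
rewrite /qpoch big_ord_recl expr0 mulr1 mulrC rmorph_prod; congr (_ * _).
apply: eq_bigr => i _.
rewrite rmorphB rmorph1 !rmorphM rmorphXn /= dilateX !dilateC exprS.
by rewrite -!mulrA; congr (1 - _ * _); rewrite mulrCA.
Qed.

(** The limit of [dilate_qpoch].  The coefficient of t^k in any coefficient of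
    the infinite product is already that of the product of k + 1 factors, and
    the dilation by t never lowers the degree in t, so the finite identity can
    be read off coefficient by coefficient. *)
Lemma qpoch_infz_dilate (R : comNzRingType) (c : R) :
  qpoch_infz c =
    (1 - fpsC (fpsC c) * fpsX {fps R}) * dilate (fpsX R) (qpoch_infz c).
Proof.
set t := fpsX R.
apply: fpsP => i; apply: fpsP => k.
(* k + 2 factors on the left so that, one factor being split off, k + 1 remain
   on the right. *)
rewrite (@qpoch_inf_coef _ _ _ _ k.+2) // -dilate_qpoch.
set P := qpoch _ _ k.+1.
have agree j l : (l <= k)%N ->
    fcoef (fcoef (dilate t P) j) l = fcoef (fcoef (dilate t (qpoch_infz c)) j) l.
  move=> lk; rewrite !fcoef_dilate !fcoefXnM; case: ifP => // _.
  rewrite (@qpoch_inf_coef _ _ _ _ k.+1) //.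
  by rewrite ltnS (leq_trans (leq_subr _ _)).
have coefBM (f : {fps {fps R}}) :
    fcoef (fcoef ((1 - fpsC (fpsC c) * fpsX {fps R}) * f) i) k =
    fcoef (fcoef f i) k - c * fcoef (fcoef (fpsX {fps R} * f) i) k.
  by rewrite mulrBl mul1r -mulrA -fcoefCM -fcoefCM.
rewrite mulrC !coefBM agree //; congr (_ - _ * _).
case: i {coefBM} => [|i]; first by rewrite !fcoefXM0.
by rewrite !fcoefXMS agree.
Qed.

Lemma qpoch_infz_0 (R : comNzRingType) (c : R) : fcoef (qpoch_infz c) 0 = 1.
Proof.
apply: fpsP => k; rewrite (@qpoch_inf_coef _ _ _ _ k.+1) //.
congr (fcoef _ k); elim: k.+1 => [|r IH]; first by rewrite /qpoch big_ord0.
rewrite qpochS fcoefM big_ord1 IH mul1r fcoefD fcoefN -mulrA fcoefCM fcoefXM0.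
by rewrite mulr0 subr0.
Qed.

(** Euler's first identity: e(cz) and (cz; t)_oo satisfy inverse functional
    equations. *)
Lemma qpoch_infz_qexp (R : comUnitRingType) (c : R) :
  qpoch_infz c * dilate (fpsC c) (qexp (fpsX R)) = 1.
Proof.
apply: (@fps_dilate_inv _ (fpsX R) (1 - fpsC (fpsC c) * fpsX {fps R})).
- exact: fpsX_pow_unit.
- exact: qpoch_infz_0.
- by rewrite /= mul1r /qpoch big_ord0 invr1.
- exact: qpoch_infz_dilate.
rewrite dilate_comp mulrC -dilate_comp (dilate_qexp (@fpsX_pow_unit R)).
by rewrite rmorphM rmorphB rmorph1 /= dilateX.
Qed.

(** The relation E(z) e(-z) = 1, by inverse functional equations again. *)
Lemma qexp_qExp (K : comUnitRingType) (t : K) :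
  (forall n, 1 - t ^+ n.+1 \is a GRing.unit) ->
  qExp t * dilate (-1) (qexp t) = 1.
Proof.
move=> ut; apply: (@fps_dilate_inv _ t (1 + fpsX K)) => //.
- by rewrite /= /qpoch big_ord0 divr1.
- by rewrite /= mul1r /qpoch big_ord0 invr1.
- exact: qExp_dilate.
rewrite dilate_comp mulrC -dilate_comp dilate_qexp //.
by rewrite rmorphM rmorphB rmorph1 /= dilateX rmorphN1 mulN1r opprK.
Qed.

(** Euler's second identity: both sides are inverse to e(-cz), by
    [qpoch_infz_qexp] and [qexp_qExp]. *)
Lemma qpoch_infz_qExp (R : comUnitRingType) (c : R) :
  qpoch_infz (- c) = dilate (fpsC c) (qExp (fpsX R)).
Proof.
have /(congr1 (dilate (fpsC c))) := qexp_qExp (@fpsX_pow_unit R).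
rewrite rmorphM rmorph1 /= dilate_comp mulrN1 => H.
have := qpoch_infz_qexp (- c); rewrite rmorphN.
move/(congr1 ( *%R (dilate (fpsC c) (qExp (fpsX R))))).
by rewrite mulr1 mulrCA H mulr1.
Qed.

(** * Inversions of the shuffled deck *)

Fixpoint seq_ninv (s : seq nat) : nat :=
  if s is x :: s' then (count (fun y => y < x) s' + seq_ninv s')%N else 0%N.

Lemma seq_ninvE (s : seq nat) :
  seq_ninv s = (\sum_(i < size s) \sum_(j < size s)
    ((i < j) && (nth 0 s j < nth 0 s i) : nat))%N.
Proof.
elim: s => [|x s IH]; first by rewrite big_ord0.
rewrite /= big_ord_recl big_ord_recl /= add0n; congr (_ + _)%N.
  by rewrite -sumn_count sumnE big_map (big_nth 0) big_mkord.
by rewrite IH; apply: eq_bigr => i _; rewrite [RHS]big_ord_recl add0n.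
Qed.

Lemma perm_ninv_shelf (n m : nat) (w : choices n m) :
  perm_ninv (shelf_perm w) = seq_ninv [seq val c | c <- deck w].
Proof.
have sd : size [seq val c | c <- deck w] = n.
  by rewrite size_map (eqP (deck_size w)).
rewrite seq_ninvE sd /perm_ninv -sum1_card pair_bigA /= big_mkcond /=.
apply: eq_bigr => -[i j] _; rewrite inE /= !permE !(tnth_nth i) /=.
by rewrite !(nth_map i) ?(eqP (deck_size w)) //.
Qed.

Lemma seq_ninv_succ (s : seq nat) : seq_ninv [seq x.+1 | x <- s] = seq_ninv s.
Proof. by elim: s => //= x s ->; rewrite count_map. Qed.

(** A new minimum is inverted exactly with the entries before it; the
    successors leave room for 0 without changing the relative order. *)
Lemma seq_ninv_insert0 (s1 s2 : seq nat) :
  seq_ninv ([seq x.+1 | x <- s1] ++ 0%N :: [seq x.+1 | x <- s2]) =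
  (size s1 + seq_ninv (s1 ++ s2))%N.
Proof.
elim: s1 => [|x s IH] /=; first by rewrite count_pred0 seq_ninv_succ.
have cS r : count (fun y => y < x.+1)%N [seq y.+1 | y <- r] =
    count (fun y => y < x)%N r by rewrite count_map.
by rewrite IH !count_cat /= !cS; lia.
Qed.

Definition choice_cons (n m : nat) (l : 'I_m * bool) (w : choices n m) :
    choices n.+1 m :=
  [ffun c => if unlift ord0 c is Some d then w d else l].

Lemma choice_cons0 (n m : nat) (l : 'I_m * bool) (w : choices n m) :
  choice_cons l w ord0 = l.
Proof. by rewrite ffunE unlift_none. Qed.

Lemma choice_consS (n m : nat) (l : 'I_m * bool) (w : choices n m) c :
  choice_cons l w (lift ord0 c) = w c.
Proof. by rewrite ffunE liftK. Qed.

Lemma sum_choice_cons (V : nmodType) (n m : nat) (F : choices n.+1 m -> V) :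
  \sum_(w : choices n.+1 m) F w =
  \sum_(l : 'I_m * bool) \sum_(w : choices n m) F (choice_cons l w).
Proof.
rewrite pair_bigA /=.
rewrite (reindex (fun lw : ('I_m * bool) * choices n m =>
  choice_cons lw.1 lw.2)) //=.
exists (fun w : choices n.+1 m => (w ord0, [ffun c => w (lift ord0 c)])).
  move=> [l w] _ /=; rewrite choice_cons0; congr (_, _).
  by apply/ffunP => c; rewrite ffunE choice_consS.
move=> w _ /=; apply/ffunP => c.
case: (unliftP ord0 c) => [d ->|->]; first by rewrite choice_consS ffunE.
by rewrite choice_cons0.
Qed.

Lemma shelf_piles_cons (n m : nat) (l : 'I_m * bool) (w : choices n m) s :
  shelf_piles (choice_cons l w) s =
  place (choice_cons l w) ord0
    (fun s => [seq lift ord0 c | c <- shelf_piles w s]) s.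
Proof.
rewrite /shelf_piles enum_ordSl /=.
have -> : foldr (place (choice_cons l w)) (fun=> [::])
    [seq lift ord0 i | i <- enum 'I_n] =
    fun s => [seq lift ord0 c | c <- foldr (place w) (fun=> [::]) (enum 'I_n) s].
  elim: (enum 'I_n) => //= c e ->; apply: boolp.funext => k.
  rewrite /place choice_consS; case: ifP => // _.
  by case: (w c).2 => //=; rewrite map_rcons.
by [].
Qed.

(** The number of shelves whose cards lie above a card dealt last with letter l:
    a card put at the bottom also has its own shelf above it. *)
Definition cutoff (m : nat) (l : 'I_m * bool) : nat := (l.1 + ~~ l.2)%N.

(** A card on top of shelf s follows exactly shelves 0, ..., s - 1, and a card at
    the bottom of shelf s follows exactly shelves 0, ..., s: the place where the
    last dealt card cuts the old deck is always a boundary between shelves. *)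
Lemma deck_cons (n m : nat) (l : 'I_m * bool) (w : choices n m) :
  let above := flatten [seq shelf_piles w s | s <- take (cutoff l) (enum 'I_m)] in
  let below := flatten [seq shelf_piles w s | s <- drop (cutoff l) (enum 'I_m)] in
  deck (choice_cons l w) =
    [seq lift ord0 c | c <- above] ++ ord0 :: [seq lift ord0 c | c <- below].
Proof.
case: l => s b above below; set l := (s, b) in above below *.
set w' := choice_cons l w.
(* Only the shelf receiving the card changes, apart from the relabelling. *)
have other e : s \notin e -> flatten [seq shelf_piles w' k | k <- e] =
    [seq lift ord0 c | c <- flatten [seq shelf_piles w k | k <- e]].
  move=> se; rewrite map_flatten -map_comp; congr flatten.
  apply/eq_in_map => k ke /=.
  rewrite shelf_piles_cons /place choice_cons0 /=; case: eqP => // ks.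
  by rewrite -ks ke in se.
have ss : (s < size (enum 'I_m))%N by rewrite size_enum_ord.
have Ds : drop s (enum 'I_m) = s :: drop s.+1 (enum 'I_m).
  by rewrite (drop_nth s) // nth_ord_enum.
have Ts : take s.+1 (enum 'I_m) = rcons (take s (enum 'I_m)) s.
  by rewrite (take_nth s) // nth_ord_enum.
have := enum_uniq 'I_m.
rewrite -[X in uniq X](cat_take_drop s) Ds cat_uniq /= => /and4P[_].
rewrite negb_or => /andP[sT _] sD _.
rewrite /deck -[X in flatten (map _ X)](cat_take_drop s) Ds.
rewrite map_cat flatten_cat /=.
rewrite !other // shelf_piles_cons /place choice_cons0 /= eqxx.
rewrite {}/above {}/below /cutoff {other}/w' {}/l /=; case: b => /=.
  by rewrite addn0 Ds /= map_cat.
by rewrite addn1 Ts map_rcons flatten_rcons map_cat cat_rcons -catA.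
Qed.

Lemma size_shelf_pile (n m : nat) (w : choices n m) s :
  size (shelf_piles w s) = (\sum_(c < n) ((w c).1 == s))%N.
Proof.
rewrite /shelf_piles -big_enum /=.
elim: (enum 'I_n) => [|c e IH] /=; first by rewrite big_nil.
rewrite big_cons -IH {1}/place eq_sym; case: eqP => //= _.
by case: (w c).2 => //=; rewrite size_rcons.
Qed.

Lemma size_above (n m r : nat) (w : choices n m) :
  size (flatten [seq shelf_piles w s | s <- take r (enum 'I_m)]) =
  (\sum_(c < n) ((w c).1 < r))%N.
Proof.
rewrite size_flatten /shape -map_comp sumnE big_map.
under eq_bigr do rewrite /= size_shelf_pile.
rewrite exchange_big; apply: eq_bigr => c _ /=.
have := count_uniq_mem (w c).1 (take_uniq r (enum_uniq 'I_m)).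
rewrite in_take ?mem_enum // index_enum_ord => <-.
by rewrite -sumn_count sumnE big_map; apply: eq_bigr => s _; rewrite eq_sym.
Qed.

(** The statistic behind the recursion: the inversions of the new card depend on
    the old word only through the number of letters below the cutoff. *)
Lemma ninv_cons (n m : nat) (l : 'I_m * bool) (w : choices n m) :
  perm_ninv (shelf_perm (choice_cons l w)) =
  (\sum_(c < n) ((w c).1 < cutoff l) + perm_ninv (shelf_perm w))%N.
Proof.
have lift0 (r : seq 'I_n) : [seq val c | c <- [seq lift ord0 c | c <- r]] =
    [seq x.+1 | x <- [seq val c | c <- r]] by rewrite -!map_comp.
rewrite !perm_ninv_shelf deck_cons map_cat map_cons !lift0.
rewrite seq_ninv_insert0 size_map size_above -map_cat -flatten_cat -map_cat.
by rewrite cat_take_drop.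
Qed.

(** * The recursion for weighted words *)

Definition word_gf (K : comNzRingType) (n m : nat) (t : K)
    (x : 'I_m * bool -> K) : K :=
  \sum_(w : choices n m) (\prod_(c < n) x (w c)) * t ^+ perm_ninv (shelf_perm w).

(** The weights seen by the remaining cards once a card with cutoff r is split
    off: each card on a shelf below r carries one more inversion. *)
Definition twist (K : comNzRingType) (m : nat) (t : K) (r : nat)
    (x : 'I_m * bool -> K) (l : 'I_m * bool) : K :=
  t ^+ (l.1 < r) * x l.

Lemma word_gfS (K : comNzRingType) (n m : nat) (t : K)
    (x : 'I_m * bool -> K) :
  word_gf n.+1 t x =
  \sum_(l : 'I_m * bool) x l * word_gf n t (twist t (cutoff l) x).
Proof.
rewrite /word_gf sum_choice_cons; apply: eq_bigr => l _.
rewrite mulr_sumr; apply: eq_bigr => w _.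
rewrite big_ord_recl choice_cons0 -mulrA; congr (_ * _).
under eq_bigr do rewrite choice_consS.
rewrite ninv_cons exprD mulrA /twist big_split /= expr_sum; congr (_ * _).
by rewrite mulrC.
Qed.

(** * The product of shelf series *)

Definition shelf_gf (K : comUnitRingType) (t a b : K) : {fps K} :=
  dilate a (qexp t) * dilate b (qExp t).

(** Dilating e first and E second: the e-part contributes a z times the undilated
    series and the E-part b z times the dilated one.  This asymmetry matches the
    two cutoffs s and s + 1 of the letters of shelf s. *)
Lemma shelf_gf_step (K : comUnitRingType) (t a b : K) :
  (forall n, 1 - t ^+ n.+1 \is a GRing.unit) ->
  shelf_gf t a b - shelf_gf t (t * a) (t * b) =
  fpsX K * (fpsC a * shelf_gf t a b + fpsC b * shelf_gf t (t * a) (t * b)).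
Proof.
move=> ut; rewrite /shelf_gf.
have -> : dilate (t * a) (qexp t) = (1 - fpsC a * fpsX K) * dilate a (qexp t).
  by rewrite mulrC -dilate_comp dilate_qexp // rmorphM rmorphB rmorph1 /= dilateX.
have -> : dilate b (qExp t) = (1 + fpsC b * fpsX K) * dilate (t * b) (qExp t).
  rewrite {1}(qExp_dilate ut) rmorphM rmorphD rmorph1 /= dilateX dilate_comp.
  by rewrite [b * t]mulrC.
ring.
Qed.

Lemma shelf_gf_dilate (K : comUnitRingType) (t u a b : K) :
  dilate u (shelf_gf t a b) = shelf_gf t (u * a) (u * b).
Proof. by rewrite /shelf_gf rmorphM /= !dilate_comp. Qed.

Lemma shelf_gf0 (K : comUnitRingType) (t a b : K) :
  fcoef (shelf_gf t a b) 0 = 1.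
Proof.
by rewrite fcoefM big_ord1 /= /qpoch !big_ord0 !expr0 !mul1r invr1 mulr1.
Qed.

Definition shelves_gf (K : comUnitRingType) (m : nat) (t : K)
    (x : 'I_m * bool -> K) : {fps K} :=
  \prod_(s < m) shelf_gf t (x (s, true)) (x (s, false)).

(** Let J r be the product with the first r shelves dilated by t, so that J 0 is
    H(z) and J m is H(tz).  The step from J s to J (s + 1) changes only shelf s,
    where [shelf_gf_step] applies; its two terms are the contributions of the
    two letters of shelf s, whose twisted products are J s and J (s + 1). *)
Lemma shelves_gf_step (K : comUnitRingType) (m : nat) (t : K)
    (x : 'I_m * bool -> K) :
  (forall n, 1 - t ^+ n.+1 \is a GRing.unit) ->
  shelves_gf t x - dilate t (shelves_gf t x) =
  fpsX K *
    \sum_(l : 'I_m * bool) fpsC (x l) * shelves_gf t (twist t (cutoff l) x).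
Proof.
move=> ut; pose J r := shelves_gf t (twist t r x).
have -> : shelves_gf t x = J 0%N.
  by apply: eq_bigr => s _; rewrite /twist !mul1r.
have -> : dilate t (J 0%N) = J m.
  rewrite /J /shelves_gf rmorph_prod; apply: eq_bigr => s _ /=.
  by rewrite shelf_gf_dilate /twist /= ltn_ord !mul1r.
have -> : J 0%N - J m = \sum_(s < m) (J s - J s.+1).
  rewrite -opprB -(telescope_sumr J (leq0n m)) big_mkord -sumrN.
  by apply: eq_bigr => s _; rewrite opprB.
have -> : \sum_(l : 'I_m * bool)
      fpsC (x l) * shelves_gf t (twist t (cutoff l) x) =
    \sum_(s < m) \sum_(b : bool) fpsC (x (s, b)) * J (cutoff (s, b)).
  by rewrite pair_bigA; apply: eq_bigr => -[].
rewrite mulr_sumr; apply: eq_bigr => s _; rewrite big_bool /cutoff /= addn0 addn1.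
have split r : J r = shelf_gf t (twist t r x (s, true)) (twist t r x (s, false)) *
    \prod_(k < m | k != s)
      shelf_gf t (twist t r x (k, true)) (twist t r x (k, false)).
  by rewrite /J /shelves_gf (bigD1 s).
have rest : \prod_(k < m | k != s)
      shelf_gf t (twist t s.+1 x (k, true)) (twist t s.+1 x (k, false)) =
    \prod_(k < m | k != s)
      shelf_gf t (twist t s x (k, true)) (twist t s x (k, false)).
  apply: eq_bigr => k ks; rewrite /twist /=.
  by rewrite ltnS leq_eqVlt (inj_eq val_inj) (negbTE ks).
rewrite !split rest /twist /= ltnn ltnS leqnn !mul1r expr1 -mulrBl.
rewrite shelf_gf_step //.
ring.
Qed.

(** A form of MacMahon's theorem on inversions of words, with all contents
    summed at once: both sides satisfy the recursion of [word_gfS]. *)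
Lemma word_gf_shelves (K : comUnitRingType) (n m : nat) (t : K)
    (x : 'I_m * bool -> K) :
  (forall n, 1 - t ^+ n.+1 \is a GRing.unit) ->
  word_gf n t x = qpoch t t n * fcoef (shelves_gf t x) n.
Proof.
move=> ut; elim: n x => [|n IH] x.
  rewrite /qpoch big_ord0 mul1r.
  have -> : fcoef (shelves_gf t x) 0 = 1.
    rewrite /shelves_gf; elim/big_ind: _ => // [f g f1 g1|s _].
      by rewrite fcoefM big_ord1 f1 g1 mulr1.
    exact: shelf_gf0.
  rewrite /word_gf (eq_bigr (fun=> 1)); last first.
    move=> w _; rewrite big_ord0 mul1r perm_ninv_shelf.
    by case: (deck w) (deck_size w).
  by rewrite sumr_const card_ffun card_ord expn0.
rewrite word_gfS; under eq_bigr do rewrite IH mulrCA.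
rewrite -mulr_sumr qpochS -mulrA; congr (_ * _).
have /(congr1 (fun f : {fps K} => fcoef f n.+1)) := shelves_gf_step x ut.
rewrite fcoefXMS fcoef_sum fcoefD fcoefN fcoef_dilate => H.
rewrite -exprS mulrBl mul1r H; apply: eq_bigr => l _.
by rewrite fcoefCM.
Qed.

(** * Coefficients of a product of series *)

Definition fps_trunc (K : comNzRingType) (n : nat) (f : {fps K}) : {fps K} :=
  \sum_(i < n.+1) fpsC (fcoef f i) * fpsX K ^+ i.

Lemma fcoefCXn (K : comNzRingType) (c : K) r n :
  fcoef (fpsC c * fpsX K ^+ r) n = c *+ (r == n).
Proof.
rewrite fcoefCM -[fpsX K ^+ r]mulr1 fcoefXnM fcoef1 subn_eq0.
by case: ltngtP => _; rewrite ?mulr0 ?mulr1.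
Qed.

Lemma fcoef_trunc (K : comNzRingType) (n k : nat) (f : {fps K}) :
  (k <= n)%N -> fcoef (fps_trunc n f) k = fcoef f k.
Proof.
move=> kn; rewrite fcoef_sum (bigD1 (Ordinal (kn : k < n.+1)%N)) //.
rewrite fcoefCXn eqxx big1 => [|i]; first exact: addr0.
by rewrite -(inj_eq val_inj) fcoefCXn /= => /negbTE ->.
Qed.

(** Coefficients up to degree n of a product only involve those of its factors.
    This replaces series by finite sums, which can be distributed. *)
Lemma fcoef_prod_trunc (K : comNzRingType) (m n : nat) (f : 'I_m -> {fps K}) :
  forall k, (k <= n)%N ->
  fcoef (\prod_(j < m) f j) k = fcoef (\prod_(j < m) fps_trunc n (f j)) k.
Proof.
elim/big_ind2: _ => // [f1 g1 f2 g2 fg1 fg2 k kn|j _ k kn].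
  rewrite !fcoefM; apply: eq_bigr => i _.
  rewrite fg1 ?fg2 //; first by rewrite (leq_trans (leq_subr _ _)).
  by rewrite (leq_trans _ kn) // -ltnS.
by rewrite fcoef_trunc.
Qed.

Lemma prod_trunc (K : comNzRingType) (m n : nat) (f : 'I_m -> {fps K}) :
  \prod_(j < m) fps_trunc n (f j) =
  \sum_(a : wcomp m n) fpsC (\prod_(j < m) fcoef (f j) (a j)) * fpsX K ^+ vsum a.
Proof.
rewrite bigA_distr_bigA; apply: eq_bigr => a _.
by rewrite big_split /= prodrXr -rmorph_prod.
Qed.

Lemma fcoef_prod2 (K : comNzRingType) (m n : nat) (f g : 'I_m -> {fps K}) :
  fcoef (\prod_(j < m) (f j * g j)) n =
  \sum_(ab in AB m n)
    \prod_(j < m) (fcoef (f j) (ab.1 j) * fcoef (g j) (ab.2 j)).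
Proof.
transitivity (fcoef (\prod_(j < m) fps_trunc n (f j) *
    \prod_(j < m) fps_trunc n (g j)) n).
  rewrite [\prod_(j < m) (f j * g j)]big_split !fcoefM; apply: eq_bigr => i _.
  by congr (_ * _); apply: fcoef_prod_trunc; rewrite ?leq_subr // -ltnS.
rewrite !prod_trunc big_distrlr /= pair_bigA fcoef_sum [RHS]big_mkcond.
apply: eq_bigr => -[a b] _; rewrite mulrACA -exprD -rmorphM fcoefCXn /=.
by rewrite inE /= big_split /= -/(vsum a) -/(vsum b) big_split; case: eqP.
Qed.

(** * The generating function of inversions *)

Theorem theorem2p14 (R : realType) (n m : nat) (p q : R)
    (hn : (1 <= n)%N) (hm : (1 <= m)%N) (hp : 0 < p < 1) (hq : q = 1 - p) :
  let t : {fps R} := fpsX R in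
  let S : {fps R} :=
    \sum_(ab in AB m n)
      tmultinom R ab * (\prod_(j < m) t ^+ 'C(ab.2 j, 2))
      * fpsC ((p / m%:R) ^+ vsum ab.1) * fpsC ((q / m%:R) ^+ vsum ab.2) in
  fps_expect (shelf_law n m p) (fun s : 'S_n => t ^+ perm_ninv s) = S
  /\ S = qpoch t t n / m%:R ^+ n
         * fcoef ((qpoch_infz (- q) / qpoch_infz p) ^+ m) n.
Proof.
move=> t S; have ut := @fpsX_pow_unit R.
pose x (l : 'I_m * bool) : {fps R} := fpsC ((if l.2 then p else q) / m%:R).
have SE : S = qpoch t t n * fcoef (shelves_gf t x) n.
  rewrite /shelves_gf fcoef_prod2 mulr_sumr; apply: eq_bigr => ab _.
  rewrite /tmultinom -prodrV => [|j _]; last by rewrite unitrM !qpoch_unit.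
  rewrite /vsum -!prodrXr !rmorph_prod -!mulrA -!big_split; congr (_ * _).
  apply: eq_bigr => j _; rewrite invrM ?qpoch_unit //= !rmorphXn /=.
  rewrite -/t; ring.
split.
  rewrite SE -word_gf_shelves //.
  rewrite /fps_expect /word_gf (partition_big (@shelf_perm n m) predT) //=.
  apply: eq_bigr => s _; rewrite /shelf_law rmorph_sum mulr_suml /=.
  apply: eq_bigr => w /eqP <-; rewrite rmorph_prod; congr (_ * _).
  by apply: eq_bigr => c _; rewrite /x mulrC -hq.
have minv : (m%:R : {fps R})^-1 = fpsC m%:R^-1.
  have mu : (m%:R : {fps R}) * fpsC m%:R^-1 = 1.
    rewrite -(rmorph_nat (@fpsC R)) -rmorphM divff ?rmorph1 //.
    by rewrite pnatr_eq0 -lt0n.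
  have um : (m%:R : {fps R}) \is a GRing.unit.
    by apply/unitrPr; exists (fpsC m%:R^-1).
  by apply: (mulrI um); rewrite mu divrr.
have gfE : shelves_gf t x =
    dilate (fpsC m%:R^-1) ((qpoch_infz (- q) / qpoch_infz p) ^+ m).
  have -> : (qpoch_infz p)^-1 = dilate (fpsC p) (qexp t).
    by rewrite -[LHS]mulr1 -(qpoch_infz_qexp p) mulKr // qpoch_infz_unit.
  have -> : shelves_gf t x = shelf_gf t (fpsC (p / m%:R)) (fpsC (q / m%:R)) ^+ m.
    by rewrite /shelves_gf /x /= prodr_const card_ord.
  rewrite qpoch_infz_qExp [dilate _ _ * _]mulrC -/(shelf_gf t (fpsC p) (fpsC q)).
  by rewrite rmorphXn /= shelf_gf_dilate -!rmorphM /= ![m%:R^-1 * _]mulrC.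
by rewrite SE gfE fcoef_dilate -exprVn minv -mulrA.
Qed.
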